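(* Let $n\geq 2$ and $M>2n$ be integers, $\Omega>0$, $\omega_q=-\Omega+(q-1)\frac{2\Omega}{M-1}$, $q=1,\dots,M$. Let $\mu=\sum_{j=1}^n a_j\delta_{y_j}$ with $a_j\in\mathbb C\setminus\{0\}$ and pairwise distinct $y_j\in I(n,\Omega):=\big[-\frac{(n-1)\pi}{2\Omega},\frac{(n-1)\pi}{2\Omega}\big]$, $m_{\min}=\min_j|a_j|$, $d_{\min}=\min_{p\neq j}|y_p-y_j|$, and let $\mathbf Y=[\mu]+\mathbf W$ with $\|\mathbf W\|_\infty<\sigma$. Assume $$d_{\min}\geq \frac{5.88\pi e}{\Omega}\Big(\frac{\sigma}{m_{\min}}\Big)^{\frac{1}{2n-1}}.$$ If $\hat\mu=\sum_{j=1}^n\hat a_j\delta_{\hat y_j}$ with $\hat y_j\in I(n,\Omega)$ satisfies $\|[\hat\mu]-\mathbf Y\|_\infty<\sigma$, then $\hat\mu$ is within the $\frac{d_{\min}}{2}$-neighborhood of $\mu$, and after reordering the $\hat y_j$, $$|\hat y_j-y_j|\leq \frac{C(n)}{\Omega}\,SRF^{2n-2}\,\frac{\sigma}{m_{\min}},\qquad 1\le j\le n,$$ where $SRF=\frac{\pi}{\Omega d_{\min}}$ and $C(n)=n\,2^{4n-2}e^{2n}\pi^{-1/2}$.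
   Context: For a discrete measure $\nu=\sum_j b_j\delta_{x_j}$ on $\mathbb R$, $\mathcal F\nu(\omega)=\sum_j b_je^{ix_j\omega}$ and $[\nu]=(\mathcal F\nu(\omega_1),\dots,\mathcal F\nu(\omega_M))^T\in\mathbb C^M$. Given $\mu=\sum_{j=1}^n a_j\delta_{y_j}$ and $\delta>0$ such that the intervals $(y_k-\delta,y_k+\delta)$, $1\le k\le n$, are pairwise disjoint, a measure $\hat\mu=\sum_{j=1}^n\hat a_j\delta_{\hat y_j}$ is within the $\delta$-neighborhood of $\mu$ if each $\hat y_j$ lies in one and only one of these $n$ intervals. *)

(* Defs.v *)
(* classical reals. Complex numbers are represented by
   pairs (real part, imaginary part) of reals. *)
From Stdlib Require Import Reals Lra.
Open Scope R_scope.

Fixpoint rsum (n : nat) (f : nat -> R) : R :=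
  match n with
  | O => 0
  | S k => rsum k f + f k
  end.

Definition cmod (x y : R) : R := sqrt (x ^ 2 + y ^ 2).

(* A discrete measure nu = sum_{j<n} b_j delta_{x_j}, with
   b_j = bre j + i bim j.  Its Fourier transform
   F nu (w) = sum_j b_j e^{i x_j w}, real and imaginary parts. *)
Definition FT_re (n : nat) (bre bim x : nat -> R) (w : R) : R :=
  rsum n (fun j => bre j * cos (x j * w) - bim j * sin (x j * w)).
Definition FT_im (n : nat) (bre bim x : nat -> R) (w : R) : R :=
  rsum n (fun j => bre j * sin (x j * w) + bim j * cos (x j * w)).

(* sample points omega_q, q = 1..M, indexed here by q0 = q-1 in 0..M-1 *)
Definition omega (M : nat) (Om : R) (q0 : nat) : R :=
  - Om + INR q0 * (2 * Om / INR (M - 1)).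

Definition in_I (n : nat) (Om : R) (t : R) : Prop :=
  - (INR (n - 1) * PI / (2 * Om)) <= t <= INR (n - 1) * PI / (2 * Om).

Definition Cn (n : nat) : R :=
  INR n * 2 ^ (4 * n - 2) * exp 1 ^ (2 * n) / sqrt PI.

Definition within_nbhd (n : nat) (y yh : nat -> R) (delta : R) : Prop :=
  forall j, (j < n)%nat ->
    exists! k, (k < n)%nat /\ Rabs (yh j - y k) < delta.

(* Main.v *)
(* Subtracting the two data sets, the measure [muhat - mu] has Fourier samples below
   [2 sigma] at 2n equispaced frequencies.  Applying to these the difference operator
   whose characteristic polynomial vanishes at all 2n nodes but y_j leaves only the
   amplitude a_j, so that with B = 2 (pi (2n-1) / Om)^(2n-1) sigma / m_min
     prod_k |y_j - yhat_k| prod_{p <> j} |y_j - y_p| <= B     for every j.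
   If some yhat_k is far from all y_p, or if two of them are close to the same y_p,
   the monic polynomial whose roots are the other yhat_k has degree one less than the
   number of available nodes; its divided difference is 1, which forces the left-hand
   side above the bound at some node.  Hence the yhat_k match the y_j one to one, and
   dividing by the factors with k <> j, bounded below by counting d_min-separated
   points around y_j, gives the error estimate. *)
From Stdlib Require Import Reals Lra Lia List Permutation ZArith Machin.
From Coquelicot Require Import Complex.
Require Import Defs.
Import ListNotations.
Open Scope R_scope.

(** * Products and sums over lists, and removal of one index *)

Definition prodl {A : Type} (f : A -> R) (l : list A) : R :=
  fold_right (fun x r => f x * r) 1 l.

Definition suml {A : Type} (f : A -> R) (l : list A) : R :=
  fold_right (fun x r => f x + r) 0 l.

Definition rem (j : nat) (l : list nat) : list nat := remove Nat.eq_dec j l.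

Lemma prodl_app A (f : A -> R) l1 l2 : prodl f (l1 ++ l2) = prodl f l1 * prodl f l2.
Proof. induction l1 as [|x l1 IH]; simpl; [ring | rewrite IH; ring]. Qed.

Lemma prodl_single A (f : A -> R) x : prodl f [x] = f x.
Proof. apply Rmult_1_r. Qed.

Lemma prodl_cons A (f : A -> R) x l : prodl f (x :: l) = f x * prodl f l.
Proof. reflexivity. Qed.

Lemma prodl_perm A (f : A -> R) l1 l2 : Permutation l1 l2 -> prodl f l1 = prodl f l2.
Proof. induction 1; simpl; try congruence; ring. Qed.

Lemma prodl_map A B (g : A -> B) (f : B -> R) l :
  prodl f (map g l) = prodl (fun x => f (g x)) l.
Proof. induction l as [|x l IH]; simpl; congruence. Qed.

Lemma prodl_ge0 A (f : A -> R) l : (forall x, In x l -> 0 <= f x) -> 0 <= prodl f l.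
Proof.
induction l as [|x l IH]; simpl; intros H; [lra|].
apply Rmult_le_pos; auto.
Qed.

Lemma prodl_le A (f g : A -> R) l :
  (forall x, In x l -> 0 <= f x <= g x) -> prodl f l <= prodl g l.
Proof.
induction l as [|x l IH]; simpl; intros H; [lra|].
apply Rmult_le_compat; try apply H; auto.
apply prodl_ge0; intros; apply H; auto.
Qed.

Lemma prodl_ext A (f g : A -> R) l :
  (forall x, In x l -> f x = g x) -> prodl f l = prodl g l.
Proof.
induction l as [|x l IH]; simpl; intros H; [reflexivity|].
rewrite H, IH; auto.
Qed.

Lemma prodl_mult A (f g : A -> R) l :
  prodl (fun x => f x * g x) l = prodl f l * prodl g l.
Proof. induction l as [|x l IH]; simpl; [ring | rewrite IH; ring]. Qed.

Lemma prodl_scale A (f : A -> R) c l :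
  prodl (fun x => c * f x) l = c ^ length l * prodl f l.
Proof. induction l as [|x l IH]; simpl; [ring | rewrite IH; ring]. Qed.

Lemma prodl_Rabs A (f : A -> R) l : Rabs (prodl f l) = prodl (fun x => Rabs (f x)) l.
Proof.
induction l as [|x l IH]; simpl; [apply Rabs_R1 | rewrite Rabs_mult, IH; ring].
Qed.

Lemma prodl_eq0 A (f : A -> R) l x : In x l -> f x = 0 -> prodl f l = 0.
Proof.
induction l as [|y l IH]; simpl; [tauto|].
intros [->|H] H0; [rewrite H0; ring | rewrite IH by assumption; ring].
Qed.

Lemma suml_ext A (f g : A -> R) l :
  (forall x, In x l -> f x = g x) -> suml f l = suml g l.
Proof.
induction l as [|x l IH]; simpl; intros H; [reflexivity|].
rewrite H, IH; auto.
Qed.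

Lemma suml_plus A (f g : A -> R) l :
  suml (fun x => f x + g x) l = suml f l + suml g l.
Proof. induction l as [|x l IH]; simpl; [ring | rewrite IH; ring]. Qed.

Lemma suml_scale A (f : A -> R) c l : suml (fun x => c * f x) l = c * suml f l.
Proof. induction l as [|x l IH]; simpl; [ring | rewrite IH; ring]. Qed.

Lemma suml_lt_const A (f : A -> R) c l :
  l <> [] -> (forall x, In x l -> f x < c) -> suml f l < INR (length l) * c.
Proof.
induction l as [|x l IH]; intros Hl H; [congruence|].
destruct l as [|x' l].
- simpl. specialize (H x (or_introl eq_refl)). lra.
- assert (suml f (x' :: l) < INR (length (x' :: l)) * c)
    by (apply IH; [discriminate | intros; apply H; right; assumption]).
  change (suml f (x :: x' :: l)) with (f x + suml f (x' :: l)).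
  change (length (x :: x' :: l)) with (S (length (x' :: l))).
  rewrite S_INR. specialize (H x (or_introl eq_refl)). lra.
Qed.

Lemma rem_perm l j : NoDup l -> In j l -> Permutation l (j :: rem j l).
Proof.
unfold rem; induction l as [|x l IH]; intros Hd Hj; [destruct Hj|].
inversion Hd as [|? ? Hx Hd']; subst; simpl.
destruct (Nat.eq_dec j x) as [->|Hne].
- rewrite notin_remove; auto.
- destruct Hj as [->|Hj]; [congruence|].
  rewrite perm_swap. constructor. auto.
Qed.

Lemma rem_NoDup l j : NoDup l -> In j l -> NoDup (rem j l).
Proof.
intros Hd Hj.
pose proof (Permutation_NoDup (rem_perm l j Hd Hj) Hd) as H. now inversion H.
Qed.

Lemma rem_length l j : NoDup l -> In j l -> length l = S (length (rem j l)).
Proof. intros Hd Hj; now rewrite (Permutation_length (rem_perm l j Hd Hj)) at 1. Qed.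

Lemma in_rem p j l : In p (rem j l) <-> In p l /\ p <> j.
Proof.
unfold rem; split.
- apply in_remove.
- intros [H1 H2]; now apply in_in_remove.
Qed.

(** * Exponential sums and the difference operators that annihilate them *)

Definition cis (t : R) : C := (cos t, sin t).

Lemma cis_plus a b : cis (a + b) = (cis a * cis b)%C.
Proof. unfold cis, Cmult; simpl; rewrite cos_plus, sin_plus; f_equal; ring. Qed.

Lemma Cmod_cis t : Cmod (cis t) = 1.
Proof.
unfold Cmod, cis; simpl. rewrite !Rmult_1_r.
pose proof (sin2_cos2 t) as H; unfold Rsqr in H.
replace (cos t * cos t + sin t * sin t) with 1 by lra. apply sqrt_1.
Qed.

Fixpoint csum (n : nat) (f : nat -> C) : C :=
  match n with
  | O => 0%C
  | S k => (csum k f + f k)%C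
  end.

Lemma csum_ext n (f g : nat -> C) : (forall j, (j < n)%nat -> f j = g j) -> csum n f = csum n g.
Proof. induction n as [|n IH]; intros H; simpl; [reflexivity|]. rewrite IH, H; auto. Qed.

Lemma csum_eq0 n (f : nat -> C) : (forall j, (j < n)%nat -> f j = 0%C) -> csum n f = 0%C.
Proof.
induction n as [|n IH]; intros H; simpl; [reflexivity|]. rewrite IH, H; auto. ring.
Qed.

Lemma csum_single n (f : nat -> C) i :
  (i < n)%nat -> (forall j, (j < n)%nat -> j <> i -> f j = 0%C) -> csum n f = f i.
Proof.
induction n as [|n IH]; intros Hi H; [lia|]; simpl.
destruct (Nat.eq_dec n i) as [->|Hne].
- rewrite csum_eq0 by (intros; apply H; lia). ring.
- rewrite IH, (H n) by (try lia; intros; apply H; lia). ring.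
Qed.

Lemma FT_csum n bre bim x w :
  (FT_re n bre bim x w, FT_im n bre bim x w) =
  csum n (fun j => ((bre j, bim j) * cis (x j * w))%C).
Proof.
unfold FT_re, FT_im. induction n as [|n IH]; simpl; [reflexivity|].
rewrite <- IH. unfold Cplus, Cmult, cis; simpl. f_equal; ring.
Qed.

(* The product of the operators [E - cis phi], [E] being the shift: it kills the
   exponentials [cis (t * phi)] and at most doubles the sup norm per factor. *)
Fixpoint annih (phis : list R) (h : nat -> C) : nat -> C :=
  match phis with
  | [] => h
  | phi :: phis' => annih phis' (fun t => (h (S t) - cis phi * h t)%C)
  end.

Lemma annih_ext phis f g u : (forall t, f t = g t) -> annih phis f u = annih phis g u.
Proof.
revert f g; induction phis as [|phi phis IH]; intros f g H; simpl; auto.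
apply IH; intros t; now rewrite !H.
Qed.

Lemma annih_minus phis f g u :
  annih phis (fun t => (f t - g t)%C) u = (annih phis f u - annih phis g u)%C.
Proof.
revert f g; induction phis as [|phi phis IH]; intros f g; simpl; [reflexivity|].
rewrite <- IH. apply annih_ext; intros t; ring.
Qed.

Lemma annih_plus phis f g u :
  annih phis (fun t => (f t + g t)%C) u = (annih phis f u + annih phis g u)%C.
Proof.
revert f g; induction phis as [|phi phis IH]; intros f g; simpl; [reflexivity|].
rewrite <- IH. apply annih_ext; intros t; ring.
Qed.

Lemma annih_0 phis u : annih phis (fun _ => 0%C) u = 0%C.
Proof.
induction phis as [|phi phis IH]; simpl; [reflexivity|].
rewrite (annih_ext _ _ (fun _ => 0%C)); [exact IH | intros t; ring].
Qed.

Lemma annih_csum phis n f u :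
  annih phis (fun t => csum n (fun k => f k t)) u =
  csum n (fun k => annih phis (f k) u).
Proof.
induction n as [|n IH]; simpl; [apply annih_0|].
rewrite (annih_plus phis (fun t => csum n (fun k => f k t)) (f n)). now rewrite IH.
Qed.

Lemma Cmod_annih_le phis h u b :
  (forall t, (t <= length phis + u)%nat -> Cmod (h t) <= b) ->
  Cmod (annih phis h u) <= 2 ^ length phis * b.
Proof.
revert h b; induction phis as [|phi phis IH]; intros h b H; simpl.
- rewrite Rmult_1_l. apply H; simpl; lia.
- replace (2 * 2 ^ length phis * b) with (2 ^ length phis * (2 * b)) by ring.
  apply IH; intros t Ht.
  eapply Rle_trans; [apply Cmod_triangle|].
  rewrite Cmod_opp, Cmod_mult, Cmod_cis.
  assert (Cmod (h (S t)) <= b) by (apply H; simpl; lia).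
  assert (Cmod (h t) <= b) by (apply H; simpl; lia). lra.
Qed.

(** An exponential is an eigenvector of the shift with eigenvalue [cis theta], so each factor
    [E - cis phi] multiplies it by [cis theta - cis phi]. The remaining phase at [u] has modulus
    1. *)
Lemma Cmod_annih_exp phis c theta u :
  Cmod (annih phis (fun t => (c * cis (INR t * theta))%C) u) =
  Cmod c * prodl (fun phi => Cmod (cis theta - cis phi)%C) phis.
Proof.
revert c; induction phis as [|phi phis IH]; intros c.
- cbn [annih prodl fold_right]. rewrite Cmod_mult, Cmod_cis. ring.
- cbn [annih prodl fold_right].
  rewrite (annih_ext _ _ (fun t => (c * (cis theta - cis phi) * cis (INR t * theta))%C)).
  + rewrite IH, Cmod_mult. unfold prodl. ring.
  + intros t. rewrite S_INR.
    replace ((INR t + 1) * theta) with (INR t * theta + theta) by ring.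
    rewrite cis_plus. ring.
Qed.

(** The operator is given the 2n-1 zeros [thetah k] for all k and [theta p] for p other than j. It
    kills every exponential except the one at [theta j], and it reads only the samples 0 to 2n-1. *)
Lemma annihilation_bound n (c ch : nat -> C) (theta thetah : nat -> R) b j :
  (forall t, (t <= 2 * n - 1)%nat ->
     Cmod (csum n (fun k => ch k * cis (INR t * thetah k)) -
           csum n (fun k => c k * cis (INR t * theta k)))%C <= b) ->
  (j < n)%nat ->
  Cmod (c j) *
    (prodl (fun k => Cmod (cis (theta j) - cis (thetah k))%C) (seq 0 n) *
     prodl (fun p => Cmod (cis (theta j) - cis (theta p))%C) (rem j (seq 0 n)))
  <= 2 ^ (2 * n - 1) * b.
Proof.
intros Hb Hj.
assert (Hin : forall k, (k < n)%nat -> In k (seq 0 n)) by (intros; apply in_seq; lia).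
set (phis := map thetah (seq 0 n) ++ map theta (rem j (seq 0 n))).
assert (Hlen : length phis = (2 * n - 1)%nat).
{ unfold phis. rewrite length_app, !length_map.
  pose proof (rem_length _ _ (seq_NoDup n 0) (Hin j Hj)) as H.
  rewrite !length_seq in *. lia. }
rewrite <- Hlen.
pose proof (Cmod_annih_le phis _ 0 b
  (fun t Ht => Hb t ltac:(rewrite Hlen in Ht; lia))) as H.
rewrite annih_minus, !annih_csum in H.
assert (E1 : csum n (fun k => annih phis (fun t => (ch k * cis (INR t * thetah k))%C) 0)
             = 0%C).
{ apply csum_eq0; intros k Hk. apply Cmod_eq_0. rewrite Cmod_annih_exp.
  rewrite (prodl_eq0 _ _ _ (thetah k)); [ring | |].
  - apply in_or_app; left; apply in_map; auto.
  - unfold Cminus. rewrite Cplus_opp_r. apply Cmod_0. }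
assert (E2 : csum n (fun k => annih phis (fun t => (c k * cis (INR t * theta k))%C) 0)
             = annih phis (fun t => (c j * cis (INR t * theta j))%C) 0).
{ apply (csum_single n (fun k => annih phis (fun t => (c k * cis (INR t * theta k))%C) 0)
    j Hj).
  intros k Hk Hne. apply Cmod_eq_0. rewrite Cmod_annih_exp.
  rewrite (prodl_eq0 _ _ _ (theta k)); [ring | |].
  - apply in_or_app; right; apply in_map; apply in_rem; auto.
  - unfold Cminus. rewrite Cplus_opp_r. apply Cmod_0. }
rewrite E1, E2 in H.
unfold Cminus in H. rewrite Cplus_0_l, Cmod_opp, Cmod_annih_exp in H.
unfold phis at 1 in H. now rewrite prodl_app, !prodl_map in H.
Qed.

(** * Chords of the unit circle compared with arcs *)

Lemma jordan_sin x : 0 <= x <= PI / 2 -> 2 / PI * x <= sin x.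
Proof.
intros [H0 H1]. pose proof PI_RGT_0 as Hpi.
destruct (Req_dec x 0) as [->|Hx0]; [rewrite sin_0; lra|].
destruct (Req_dec x (PI / 2)) as [->|Hx1].
{ rewrite sin_PI2. right. field. lra. }
assert (Hd : forall a b, a < b -> exists c, sin b - sin a = cos c * (b - a) /\ a < c < b).
{ intros a b Hab.
  destruct (MVT_cor2 sin cos a b Hab) as [c Hc]; [intros; apply derivable_pt_lim_sin|].
  now exists c. }
(* Concavity by mean values: the slope [cos c1] of the secant on [0, x] is at least the slope
   [cos c2] on [x, PI/2], hence at least the overall slope 2/PI. *)
destruct (Hd 0 x) as [c1 [E1 B1]]; [lra|].
destruct (Hd x (PI / 2)) as [c2 [E2 B2]]; [lra|].
rewrite sin_0 in E1. rewrite sin_PI2 in E2.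
assert (Hc : cos c2 <= cos c1) by (apply Rlt_le, cos_decreasing_1; lra).
set (s := cos c1) in *.
assert (1 <= PI / 2 * s).
{ assert (cos c2 * (PI / 2 - x) <= s * (PI / 2 - x)) by (apply Rmult_le_compat_r; lra).
  lra. }
assert (2 / PI <= s).
{ apply Rmult_le_reg_l with (PI / 2); [lra|].
  replace (PI / 2 * (2 / PI)) with 1 by (field; lra). assumption. }
replace (sin x) with (s * x) by lra. apply Rmult_le_compat_r; lra.
Qed.

(** The chord has length 2 sin(|a-b|/2), and the half angle lies in the range of [jordan_sin]. *)
Lemma chord_ge a b : Rabs (a - b) <= PI -> 2 / PI * Rabs (a - b) <= Cmod (cis a - cis b)%C.
Proof.
intros H. pose proof PI_RGT_0 as Hpi.
set (t := Rabs (a - b)) in *.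
assert (Ht : 0 <= t) by apply Rabs_pos.
assert (Hs : 2 / PI * (t / 2) <= sin (t / 2)) by (apply jordan_sin; lra).
assert (H0 : 0 <= 2 / PI * (t / 2)).
{ apply Rmult_le_pos; [|lra]. apply Rlt_le, Rdiv_lt_0_compat; lra. }
replace (Cmod (cis a - cis b)%C) with (2 * sin (t / 2)); [lra|].
unfold Cmod, cis, Cminus, Cplus, Copp; simpl.
symmetry. rewrite <- (sqrt_Rsqr (2 * sin (t / 2))) by lra. f_equal.
assert (Hc : cos (a - b) = 1 - 2 * sin (t / 2) * sin (t / 2)).
{ rewrite <- cos_2a_sin. replace (2 * (t / 2)) with t by lra.
  unfold t, Rabs. destruct (Rcase_abs (a - b)); [now rewrite cos_neg|reflexivity]. }
rewrite cos_minus in Hc.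
pose proof (sin2_cos2 a). pose proof (sin2_cos2 b). unfold Rsqr in *. lra.
Qed.

(** * Products of distances to separated points *)

Lemma prodl_seq_le (psi : nat -> R) l :
  NoDup l -> (forall i, 0 <= psi i) -> (forall i k, (i <= k)%nat -> psi i <= psi k) ->
  prodl psi (seq 0 (length l)) <= prodl psi l.
Proof.
intros Hd Hpos Hmono. remember (length l) as m eqn:Em. symmetry in Em.
revert l Hd Em; induction m as [|m IH]; intros l Hd Em.
- apply length_zero_iff_nil in Em; subst. apply Rle_refl.
(* Pigeonhole: m+1 distinct naturals cannot all lie below m. An element k >= m pays for the last
   factor [psi m], and the induction hypothesis handles the rest. *)
- destruct (Exists_dec (fun k => (m <= k)%nat) l (fun k => le_dec m k)) as [H|H].
  + apply Exists_exists in H as [k [Hk Hmk]].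
    rewrite (prodl_perm _ _ _ _ (rem_perm l k Hd Hk)), seq_S, prodl_app; simpl.
    rewrite (rem_length l k Hd Hk) in Em.
    rewrite Rmult_1_r, Rmult_comm.
    apply Rmult_le_compat; auto using prodl_ge0, rem_NoDup.
  + exfalso.
    assert (Hi : incl l (seq 0 m)).
    { intros k Hk. apply in_seq. rewrite <- Forall_Exists_neg, Forall_forall in H.
      specialize (H k Hk). lia. }
    apply NoDup_incl_length in Hi; auto. rewrite length_seq in Hi. lia.
Qed.

Lemma nat_floor g : 1 <= g ->
  let k := Z.to_nat (Int_part g) in (1 <= k)%nat /\ INR k <= g < INR k + 1.
Proof.
intros Hg k. destruct (base_Int_part g) as [H1 H2].
assert (Hz : (1 <= Int_part g)%Z).
{ apply Z.lt_pred_le, lt_IZR. simpl. lra. }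
unfold k. rewrite INR_IZR_INZ, Z2Nat.id by lia. split; [lia | lra].
Qed.

(* The points at distance in [k d, (k+1) d) on a given side of [x] are at most one,
   so the keys [2 (k - 1) + side] are distinct. *)
Lemma separated_prodl_ge (phi : R -> R) (y : nat -> R) x d l :
  0 < d -> NoDup l ->
  (forall p q, In p l -> In q l -> p <> q -> d <= Rabs (y p - y q)) ->
  (forall p, In p l -> d <= Rabs (x - y p)) ->
  (forall s, 1 <= s -> 0 <= phi s) ->
  (forall s t, 1 <= s <= t -> phi s <= phi t) ->
  prodl (fun i => phi (INR (i / 2 + 1))) (seq 0 (length l)) <=
  prodl (fun p => phi (Rabs (x - y p) / d)) l.
Proof.
intros Hd Hnd Hsep Hx Hpos Hmono.
set (fl := fun p => Z.to_nat (Int_part (Rabs (x - y p) / d))).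
set (side := fun p => if Rle_dec x (y p) then 0%nat else 1%nat).
set (key := fun p => (2 * (fl p - 1) + side p)%nat).
assert (Hg : forall p, In p l -> 1 <= Rabs (x - y p) / d).
{ intros p Hp. apply Rmult_le_reg_r with d; [lra|].
  unfold Rdiv. rewrite Rmult_assoc, Rinv_l, Rmult_1_r, Rmult_1_l by lra. auto. }
assert (Hfl : forall p, In p l ->
  (1 <= fl p)%nat /\ INR (fl p) <= Rabs (x - y p) / d < INR (fl p) + 1).
{ intros p Hp. apply nat_floor. auto. }
assert (Hside : forall p, (side p < 2)%nat).
{ intros p. unfold side. destruct (Rle_dec x (y p)); lia. }
assert (Hkey : forall p, In p l -> (key p / 2 + 1 = fl p)%nat).
{ intros p Hp. destruct (Hfl p Hp) as [H1 _]. unfold key.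
  rewrite Nat.mul_comm, Nat.div_add_l by lia.
  rewrite Nat.div_small by apply Hside. lia. }
(* Halving the key recovers the shell number [fl p], which is at most the scaled distance. Over
   distinct keys the product is least when they are 0, 1, 2, and so on. *)
apply Rle_trans with (prodl (fun p => phi (INR (key p / 2 + 1))) l).
- rewrite <- (prodl_map _ _ key (fun i => phi (INR (i / 2 + 1)))).
  rewrite <- (length_map key l).
  apply prodl_seq_le.
  + apply NoDup_map_NoDup_ForallPairs; auto.
    intros p q Hp Hq E. destruct (Nat.eq_dec p q) as [|Hne]; auto. exfalso.
    assert (Ef : fl p = fl q) by (rewrite <- !Hkey by assumption; now rewrite E).
    assert (Es : side p = side q) by (unfold key in E; lia).
    destruct (Hfl p Hp) as [_ Bp]. destruct (Hfl q Hq) as [_ Bq]. rewrite Ef in Bp.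
    assert (Hlt : forall u v, u / d < INR (fl q) + 1 -> INR (fl q) <= v / d -> u - v < d).
    { intros u v Hu Hv. assert (Huv : (u - v) / d < 1) by (rewrite Rdiv_minus_distr; lra).
      apply (Rmult_lt_compat_r d) in Huv; [|lra].
      unfold Rdiv in Huv. rewrite Rmult_assoc, Rinv_l in Huv by lra. lra. }
    pose proof (Hlt _ _ (proj2 Bp) (proj1 Bq)). pose proof (Hlt _ _ (proj2 Bq) (proj1 Bp)).
    specialize (Hsep p q Hp Hq Hne). unfold side in Es.
    destruct (Rle_dec x (y p)); destruct (Rle_dec x (y q)); try discriminate;
    unfold Rabs in *; repeat destruct Rcase_abs; lra.
  + intros i. apply Hpos. rewrite plus_INR. pose proof (pos_INR (i / 2)). change (INR 1) with 1. lra.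
  + intros i k Hik. apply Hmono. split.
    * rewrite plus_INR. pose proof (pos_INR (i / 2)). change (INR 1) with 1. lra.
    * apply le_INR. assert (i / 2 <= k / 2)%nat by (apply Nat.Div0.div_le_mono; lia). lia.
- apply prodl_le. intros p Hp. rewrite Hkey by assumption.
  destruct (Hfl p Hp) as [H1 H2]. apply le_INR in H1. simpl in H1.
  split; [apply Hpos; lra | apply Hmono; lra].
Qed.

Lemma half_INR_le i : (INR i + 1) / 2 <= INR (i / 2 + 1).
Proof.
assert (H : (i + 1 <= 2 * (i / 2 + 1))%nat).
{ pose proof (Nat.div_mod_eq i 2). pose proof (Nat.mod_upper_bound i 2). lia. }
apply le_INR in H. rewrite mult_INR, plus_INR in H. simpl (INR 1) in H. simpl (INR 2) in H. lra.
Qed.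

(** The factors are 1, 1, 2, 2, 3, 3, ..., and the one of index i is at least (i+1)/2. *)
Lemma prodl_half_ge_fact m :
  INR (fact m) / 2 ^ m <= prodl (fun i => INR (i / 2 + 1)) (seq 0 m).
Proof.
induction m as [|m IH]; [simpl; lra|].
rewrite seq_S, prodl_app. rewrite prodl_single.
rewrite fact_simpl, mult_INR, S_INR.
replace ((INR m + 1) * INR (fact m) / 2 ^ S m)
  with (INR (fact m) / 2 ^ m * ((INR m + 1) / 2))
  by (simpl; field; apply pow_nonzero; lra).
apply Rmult_le_compat; auto using half_INR_le.
- apply Rlt_le, Rdiv_lt_0_compat; [apply INR_fact_lt_0 | apply pow_lt; lra].
- pose proof (pos_INR m); lra.
Qed.

(** The indices 2q and 2q+1 share the factor (q+1)(q+1/2) = (2q+2)(2q+1)/4, whose square is exactly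
    what two steps of m add to the left-hand side. So equality holds for even m; for odd m the last
    factor (q+1)(q+1/2) exceeds the required (q+1/2)^2. *)
Lemma prodl_half_sq_ge_fact_sq m :
  INR (fact m) ^ 2 / 4 ^ m <=
  prodl (fun i => INR (i / 2 + 1) * (INR (i / 2 + 1) - 1 / 2)) (seq 0 m).
Proof.
assert (Heven : forall q, INR (fact (2 * q)) ^ 2 / 4 ^ (2 * q) =
  prodl (fun i => INR (i / 2 + 1) * (INR (i / 2 + 1) - 1 / 2)) (seq 0 (2 * q))).
{ induction q as [|q IH]; [simpl; lra|].
  replace (2 * S q)%nat with (S (S (2 * q))) by lia.
  rewrite !seq_S, !prodl_app, <- IH.
  replace (0 + S (2 * q))%nat with (q * 2 + 1)%nat by lia.
  replace (0 + 2 * q)%nat with (q * 2 + 0)%nat by lia.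
  rewrite !prodl_single, !Nat.div_add_l by lia.
  replace (1 / 2)%nat with 0%nat by reflexivity. replace (0 / 2)%nat with 0%nat by reflexivity.
  rewrite !fact_simpl, !mult_INR, !S_INR, mult_INR, !plus_INR. simpl (INR 0).
  simpl (INR 1). simpl (INR 2).
  rewrite <- !tech_pow_Rmult. field. apply pow_nonzero; lra. }
destruct (Nat.Even_or_Odd m) as [[q ->]|[q ->]]; [rewrite Heven; lra|].
replace (2 * q + 1)%nat with (S (2 * q)) by lia.
rewrite seq_S, prodl_app, <- Heven.
replace (0 + 2 * q)%nat with (q * 2 + 0)%nat by lia.
rewrite !prodl_single, !Nat.div_add_l by lia.
replace (0 / 2)%nat with 0%nat by reflexivity.
rewrite fact_simpl, mult_INR, S_INR, mult_INR, !plus_INR. simpl (INR 0).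
simpl (INR 1). simpl (INR 2). rewrite Rplus_0_r.
set (F := INR (fact (2 * q)) ^ 2 / 4 ^ (2 * q)).
replace (_ / 4 ^ S (2 * q)) with (F * ((2 * INR q + 1) ^ 2 / 4))
  by (unfold F; simpl pow; field; apply pow_nonzero; lra).
apply Rmult_le_compat_l.
- apply Rlt_le, Rdiv_lt_0_compat; apply pow_lt; [apply INR_fact_lt_0 | lra].
- pose proof (pos_INR q). nra.
Qed.

(** * Divided differences at the nodes [y p] *)

Section DividedDifferences.
Variable y : nat -> R.

(** The derivative at [y j] of the monic polynomial with roots [y p], p in [l], when j occurs once
    in [l]. *)
Definition nodal (l : list nat) (j : nat) : R := prodl (fun p => y j - y p) (rem j l).

(** The Lagrange form of the divided difference, with [f] given by its values at node indices. *)
Definition divdiff (l : list nat) (f : nat -> R) : R :=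
  suml (fun j => f j / nodal l j) l.

Definition distinct_nodes (l : list nat) : Prop :=
  NoDup l /\ forall p q, In p l -> In q l -> p <> q -> y p <> y q.

Lemma distinct_nodes_cons a l :
  distinct_nodes (a :: l) ->
  distinct_nodes l /\ ~ In a l /\ (forall j, In j l -> y j - y a <> 0).
Proof.
intros [Hd Hy]. inversion Hd as [|? ? Ha Hd']; subst. repeat split; auto.
- intros p q Hp Hq; apply Hy; now right.
- intros j Hj. apply Rminus_eq_contra, Hy; [now right | now left | congruence].
Qed.

Lemma nodal_cons_eq a l : ~ In a l -> nodal (a :: l) a = prodl (fun p => y a - y p) l.
Proof.
intros Ha. unfold nodal, rem; simpl. destruct (Nat.eq_dec a a); [|congruence].
now rewrite notin_remove.
Qed.

Lemma nodal_cons_neq a l j : j <> a -> nodal (a :: l) j = (y j - y a) * nodal l j.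
Proof.
intros Ha. unfold nodal, rem; simpl. destruct (Nat.eq_dec j a); [congruence|reflexivity].
Qed.

Lemma divdiff_cons a l f :
  ~ In a l ->
  divdiff (a :: l) f = f a / prodl (fun p => y a - y p) l +
    suml (fun j => f j / ((y j - y a) * nodal l j)) l.
Proof.
intros Ha. unfold divdiff at 1; simpl. rewrite nodal_cons_eq by assumption. f_equal.
apply suml_ext. intros j Hj. rewrite nodal_cons_neq; [reflexivity | congruence].
Qed.

(** For the common nodes this is the partial fraction identity (b-a)/((t-a)(t-b)) = 1/(t-b) -
    1/(t-a); the terms at a and b are matched separately. *)
Lemma divdiff_step a b l f :
  distinct_nodes (a :: b :: l) ->
  (y b - y a) * divdiff (a :: b :: l) f = divdiff (b :: l) f - divdiff (a :: l) f.
Proof.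
intros H. pose proof (distinct_nodes_cons _ _ H) as [Hb [Ha Hya]].
pose proof (distinct_nodes_cons _ _ Hb) as [_ [Hbl Hyb]].
assert (Hal : ~ In a l) by (intros Hin; apply Ha; now right).
assert (Hab : y b - y a <> 0) by (apply Hya; now left).
rewrite !divdiff_cons by assumption. simpl.
rewrite nodal_cons_eq by assumption.
set (wa := prodl (fun p => y a - y p) l). set (wb := prodl (fun p => y b - y p) l).
assert (E : (y b - y a) * suml (fun j => f j / ((y j - y a) * nodal (b :: l) j)) l =
  suml (fun j => f j / ((y j - y b) * nodal l j)) l
  + (- 1) * suml (fun j => f j / ((y j - y a) * nodal l j)) l).
{ rewrite <- !suml_scale, <- suml_plus. apply suml_ext. intros j Hj.
  rewrite nodal_cons_neq by congruence.
  assert (y j - y a <> 0) by (apply Hya; now right).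
  assert (y j - y b <> 0) by (apply Hyb; assumption).
  (* With [/ nodal l j] as an atom, [field] asks only that the two differences of nodes be
     nonzero. *)
  unfold Rdiv. rewrite !Rinv_mult. set (v := / nodal l j). field. auto. }
rewrite !Rmult_plus_distr_l, E. unfold Rdiv. rewrite !Rinv_mult.
set (va := / wa). set (vb := / wb). field.
split; [assumption | lra].
Qed.

(** Leibniz rule for a linear factor: write y_j - q = (y_j - y_a) + (y_a - q). The first summand
    cancels the node a from the denominators. *)
Lemma divdiff_mul_linear a l f q :
  distinct_nodes (a :: l) ->
  divdiff (a :: l) (fun j => (y j - q) * f j) =
  divdiff l f + (y a - q) * divdiff (a :: l) f.
Proof.
intros H. pose proof (distinct_nodes_cons _ _ H) as [_ [Ha Hya]].
rewrite !divdiff_cons by assumption.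
rewrite Rmult_plus_distr_l, <- suml_scale.
unfold divdiff at 1.
rewrite (suml_ext _ (fun j => (y j - q) * f j / ((y j - y a) * nodal l j))
  (fun j => f j / nodal l j + (y a - q) * (f j / ((y j - y a) * nodal l j)))).
- rewrite suml_plus. unfold Rdiv. ring.
- intros j Hj. pose proof (Hya j Hj). unfold Rdiv. rewrite !Rinv_mult.
  set (v := / nodal l j). field. assumption.
Qed.

Lemma divdiff_one l :
  distinct_nodes l -> (0 < length l)%nat ->
  divdiff l (fun _ => 1) = if (length l =? 1)%nat then 1 else 0.
Proof.
remember (length l) as m eqn:Em. symmetry in Em. revert l Em.
induction m as [|m IH]; intros l Em Hl Hm; [lia|].
destruct l as [|a [|b l]]; try discriminate.
- simpl in Em. injection Em as <-. unfold divdiff, nodal, rem; simpl.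
  destruct (Nat.eq_dec a a); [simpl; field | congruence].
- simpl in Em. injection Em as <-.
  pose proof (divdiff_step a b l (fun _ => 1) Hl) as E.
  destruct (distinct_nodes_cons _ _ Hl) as [Hbl [Ha Hya]].
  destruct (distinct_nodes_cons _ _ Hbl) as [Hl' [Hb Hyb]].
  assert (Hal : distinct_nodes (a :: l)).
  { destruct Hl as [_ Hy]. destruct Hl' as [Hd' _]. split.
    - constructor; auto. intros Hin; apply Ha; now right.
    - intros p q Hp Hq. apply Hy; simpl in *; tauto. }
  (* The two shorter differences have the same length, hence the same value, so the recurrence
     leaves (y_b - y_a) times the divided difference equal to 0. *)
  rewrite (IH (b :: l)), (IH (a :: l)) in E by (auto; simpl; lia).
  rewrite Rminus_diag in E. apply Rmult_integral in E as [E|E].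
  + exfalso. apply (Hya b); [now left | assumption].
  + exact E.
Qed.

(** Induction on the roots: the Leibniz rule removes one root and one node together, while its
    second term has degree too low for its number of nodes and vanishes. *)
Lemma divdiff_prodl l qs :
  distinct_nodes l -> (length qs < length l)%nat ->
  divdiff l (fun j => prodl (fun q => y j - q) qs) =
  if (length l =? S (length qs))%nat then 1 else 0.
Proof.
revert l; induction qs as [|q qs IH]; intros l Hl Hlen.
- simpl in *. now apply divdiff_one.
- destruct l as [|a l]; [simpl in Hlen; lia|]. simpl in Hlen. simpl prodl.
  rewrite (divdiff_mul_linear a l (fun j => prodl (fun q => y j - q) qs)) by assumption.
  destruct (distinct_nodes_cons _ _ Hl) as [Hl' _].
  rewrite !IH by (auto; simpl; lia).
  destruct (Nat.eqb_spec (length (a :: l)) (S (length qs))) as [E|_]; [simpl in E; lia|].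
  simpl. ring.
Qed.

Lemma separated_distinct d l :
  0 < d -> NoDup l ->
  (forall p q, In p l -> In q l -> p <> q -> d <= Rabs (y p - y q)) ->
  distinct_nodes l.
Proof.
intros Hd Hnd Hs. split; auto. intros p q Hp Hq Hne E.
specialize (Hs p q Hp Hq Hne). rewrite E, Rminus_diag, Rabs_R0 in Hs. lra.
Qed.

Lemma prodl_dist_ge d l j :
  0 < d -> NoDup l ->
  (forall p q, In p l -> In q l -> p <> q -> d <= Rabs (y p - y q)) ->
  In j l ->
  INR (fact (length l - 1)) / 2 ^ (length l - 1) * d ^ (length l - 1) <=
  prodl (fun p => Rabs (y j - y p)) (rem j l).
Proof.
intros Hd Hnd Hs Hj.
pose proof (rem_length l j Hnd Hj) as Hlen.
replace (length l - 1)%nat with (length (rem j l)) by lia.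
set (r := rem j l) in *.
pose proof (separated_prodl_ge (fun s => s) y (y j) d r Hd
  (rem_NoDup l j Hnd Hj)) as H.
assert (Hr : forall p, In p r -> In p l /\ p <> j) by (intros p; apply in_rem).
apply Rle_trans with (prodl (fun p => Rabs (y j - y p) / d) r * d ^ length r).
- apply Rmult_le_compat_r; [apply pow_le; lra|].
  eapply Rle_trans; [apply prodl_half_ge_fact|]. apply H.
  + intros p q Hp Hq; apply Hs; now apply Hr.
  + intros p Hp. destruct (Hr p Hp). apply Hs; auto.
  + intros; lra.
  + intros; lra.
- rewrite Rmult_comm, <- prodl_scale. right. apply prodl_ext. intros p _. field. lra.
Qed.

(* The divided difference of a monic polynomial of degree k at k+1 nodes is 1,
   so the polynomial cannot be small at all of them. *)
Lemma exists_large_node d k l qs :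
  0 < d -> NoDup l ->
  (forall p q, In p l -> In q l -> p <> q -> d <= Rabs (y p - y q)) ->
  length l = S k -> length qs = k ->
  exists j, In j l /\
    INR (fact k) ^ 2 / (INR (S k) * 4 ^ k) * d ^ (2 * k) <=
    prodl (fun q => Rabs (y j - q)) qs * prodl (fun p => Rabs (y j - y p)) (rem j l).
Proof.
intros Hd Hnd Hs Hl Hq.
set (c := INR (fact k) ^ 2 / (INR (S k) * 4 ^ k) * d ^ (2 * k)).
set (F := fun j => prodl (fun q => Rabs (y j - q)) qs *
                   prodl (fun p => Rabs (y j - y p)) (rem j l)).
destruct (Exists_dec (fun j => c <= F j) l (fun j => Rle_dec c (F j))) as [H|H].
{ apply Exists_exists in H as [j [H1 H2]]. now exists j. }
exfalso. rewrite <- Forall_Exists_neg, Forall_forall in H.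
set (w0 := INR (fact k) / 2 ^ k * d ^ k).
assert (Hw0 : 0 < w0).
{ apply Rmult_lt_0_compat; [apply Rdiv_lt_0_compat|];
    [apply INR_fact_lt_0 | apply pow_lt; lra | apply pow_lt; lra]. }
assert (HSk : 0 < INR (S k)) by (apply lt_0_INR; lia).
assert (Hc : c = w0 ^ 2 / INR (S k)).
{ unfold c, w0. rewrite !pow_mult. replace 4 with (2 ^ 2) by ring.
  rewrite <- !pow_mult, !(Nat.mul_comm 2 k), !pow_mult.
  set (s := INR (S k)) in *. field. split; [apply pow_nonzero; lra | lra]. }
pose proof (divdiff_prodl l qs (separated_distinct d l Hd Hnd Hs) ltac:(lia)) as E.
rewrite Hl, Hq, Nat.eqb_refl in E.
(* If Q W < c = w0^2/(k+1) at every node, then W >= w0 gives Q < w0/(k+1) and Q/W < 1/(k+1). The k+1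
   summands then total less than 1. *)
assert (Hlt : divdiff l (fun j => prodl (fun q => y j - q) qs)
              < INR (length l) * (/ INR (S k))).
{ apply suml_lt_const; [intros ->; discriminate|]. intros j Hj.
  eapply Rle_lt_trans; [apply Rle_abs|].
  specialize (H j Hj). apply Rnot_le_lt in H. unfold F in H.
  pose proof (prodl_dist_ge d l j Hd Hnd Hs Hj) as Hw.
  rewrite Hl in Hw. replace (S k - 1)%nat with k in Hw by lia. fold w0 in Hw.
  unfold Rdiv, nodal. rewrite Rabs_mult, Rabs_inv, !prodl_Rabs.
  set (Q := prodl (fun q => Rabs (y j - q)) qs) in *.
  set (W := prodl (fun p => Rabs (y j - y p)) (rem j l)) in *.
  assert (HQ : 0 <= Q) by (apply prodl_ge0; intros; apply Rabs_pos).
  assert (HQc : Q < c / w0).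
  { apply Rmult_lt_reg_r with w0; [assumption|].
    replace (c / w0 * w0) with c by (field; lra).
    apply Rle_lt_trans with (2 := H). apply Rmult_le_compat_l; assumption. }
  replace (/ INR (S k)) with (c / w0 * / w0) by (rewrite Hc; field; split; lra).
  apply Rle_lt_trans with (Q * / w0).
  - apply Rmult_le_compat_l; [assumption|]. apply Rinv_le_contravar; assumption.
  - apply Rmult_lt_compat_r; [apply Rinv_0_lt_compat|]; assumption. }
rewrite Hl, E, Rinv_r in Hlt by lra. lra.
Qed.

End DividedDifferences.

(** * Numerical bounds on e, PI and factorials *)

Lemma exp_pow x k : exp x ^ k = exp (INR k * x).
Proof.
induction k as [|k IH]; [simpl; now rewrite Rmult_0_l, exp_0|].
rewrite S_INR, <- tech_pow_Rmult, IH, <- exp_plus. f_equal; ring.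
Qed.

Lemma one_plus_pow_le_exp x k : -1 <= x -> (1 + x) ^ k <= exp (INR k * x).
Proof. intros Hx. rewrite <- exp_pow. apply pow_incr. pose proof (exp_ineq1_le x). lra. Qed.

Lemma exp1_ge : 26 / 10 <= exp 1.
Proof.
pose proof (one_plus_pow_le_exp (/ 16) 16 ltac:(lra)) as H.
replace (INR 16 * / 16) with 1 in H by (simpl; field).
eapply Rle_trans; [|exact H]. lra.
Qed.

Lemma PI_le : PI <= 52 / 15.
Proof.
(* The Leibniz series truncated after three terms: 4 (1 - 1/3 + 1/5) = 52/15. *)
destruct (PI_ineq 1) as [_ H]. unfold tg_alt, PI_tg in H. simpl in H. lra.
Qed.

(** A weak Stirling bound. Passing from m to m+1 multiplies the left by (m+1)(1 + 1/(m+1))^(m+1) <=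
    (m+1) e. *)
Lemma pow_le_fact_exp m : INR (S m) ^ m <= INR (fact m) * exp 1 ^ m.
Proof.
induction m as [|m IH]; [simpl; lra|].
assert (Hm : 0 < INR (S m)) by (apply lt_0_INR; lia).
replace (INR (S (S m)) ^ S m)
  with (INR (S m) ^ m * INR (S m) * (1 + / INR (S m)) ^ S m).
- pose proof (one_plus_pow_le_exp (/ INR (S m)) (S m)) as H.
  rewrite Rinv_r in H by lra.
  assert (H1 : (1 + / INR (S m)) ^ S m <= exp 1).
  { apply H. pose proof (Rinv_0_lt_compat _ Hm). lra. }
  rewrite fact_simpl, mult_INR, <- (tech_pow_Rmult (exp 1)).
  replace (INR (S m) * INR (fact m) * (exp 1 * exp 1 ^ m))
    with (INR (fact m) * exp 1 ^ m * INR (S m) * exp 1) by ring.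
  apply Rmult_le_compat; [| | |assumption].
  + apply Rmult_le_pos; [apply pow_le|]; lra.
  + apply pow_le. pose proof (Rinv_0_lt_compat _ Hm). lra.
  + apply Rmult_le_compat_r; lra.
- rewrite (Rmult_comm (INR (S m) ^ m)), tech_pow_Rmult, <- Rpow_mult_distr.
  f_equal. rewrite (S_INR (S m)). field. lra.
Qed.

(* With [n = m + 2], the left-hand side is [B / d^(2n-1)] under the separation
   hypothesis; the ratio of the two sides is monotone from [m = 4] on. *)
Lemma resolution_const_lt m :
  2 * (INR (2 * m + 3) / (588 / 100 * exp 1)) ^ (2 * m + 3) <
  INR (fact m) ^ 2 / (4 * INR (S m) * 4 ^ m).
Proof.
pose proof exp1_ge as He.
(* Here 15.288 = 5.88 * 2.6, from the rational lower bound on e; it settles m <= 4 by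
   computation. *)
assert (Hbase : forall k,
  2 * (INR (2 * k + 3) / (588 / 100 * exp 1)) ^ (2 * k + 3) <=
  2 * (INR (2 * k + 3) / (15288 / 1000)) ^ (2 * k + 3)).
{ intros k. apply Rmult_le_compat_l; [lra|]. apply pow_incr. split.
  - apply Rmult_le_pos; [apply pos_INR|]. apply Rlt_le, Rinv_0_lt_compat. lra.
  - apply Rmult_le_compat_l; [apply pos_INR|]. apply Rinv_le_contravar; lra. }
destruct (le_lt_dec m 3) as [Hm|Hm].
{ eapply Rle_lt_trans; [apply Hbase|].
  destruct m as [|[|[|[|m]]]]; [| | | |lia]; simpl; lra. }
replace m with (4 + (m - 4))%nat by lia. generalize (m - 4)%nat as q. clear m Hm.
induction q as [|q IH].
{ eapply Rle_lt_trans; [apply Hbase|]. simpl; lra. }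
replace (4 + S q)%nat with (S (4 + q)) by lia.
assert (Hm4 : 4 <= INR (4 + q)) by (rewrite plus_INR; pose proof (pos_INR q); simpl; lra).
set (m := (4 + q)%nat) in *. clearbody m.
set (t := 588 / 100 * exp 1) in *.
assert (Ht : 0 < t) by (unfold t; lra).
set (x := INR (2 * m + 3)) in *.
assert (Hx : x = 2 * INR m + 3) by (unfold x; rewrite plus_INR, mult_INR; simpl; ring).
replace (2 * S m + 3)%nat with (2 * m + 3 + 2)%nat by lia.
rewrite (plus_INR _ 2). fold x. replace (INR 2) with 2 by (simpl; ring).
set (N := (2 * m + 3)%nat) in *.
(* Since N equals x, (1 + 2/x)^N <= e^2, and this cancels the e^2 contained in t^2. The growth
   factor of the left side becomes free of e. *)
assert (Hup : 2 * ((x + 2) / t) ^ (N + 2) <=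
              2 * (x / t) ^ N * ((x + 2) ^ 2 / (588 / 100) ^ 2)).
{ replace ((x + 2) / t) with (x / t * (1 + 2 / x)) by (field; split; lra).
  rewrite pow_add, Rpow_mult_distr.
  pose proof (one_plus_pow_le_exp (2 / x) N) as H.
  assert (Hp : 0 < 2 / x) by (apply Rdiv_lt_0_compat; lra).
  replace (INR N * (2 / x)) with (1 + 1) in H by (fold x; field; lra).
  rewrite exp_plus in H. specialize (H ltac:(lra)).
  assert (0 <= (x / t) ^ N) by (apply pow_le, Rlt_le, Rdiv_lt_0_compat; lra).
  replace ((x + 2) ^ 2 / (588 / 100) ^ 2)
    with (exp 1 * exp 1 * (x / t * (1 + 2 / x)) ^ 2) by (unfold t; field; lra).
  rewrite !Rmult_assoc. apply Rmult_le_compat_l; [lra|].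
  apply Rmult_le_compat_l; [assumption|].
  rewrite <- Rmult_assoc. apply Rmult_le_compat_r; [apply pow2_ge_0 | assumption]. }
eapply Rle_lt_trans; [exact Hup|].
assert (Hpos : 0 < (x + 2) ^ 2 / (588 / 100) ^ 2)
  by (apply Rdiv_lt_0_compat; apply pow_lt; lra).
eapply Rlt_le_trans; [apply Rmult_lt_compat_r; [exact Hpos | exact IH]|].
rewrite fact_simpl, mult_INR, !S_INR, <- (tech_pow_Rmult 4).
set (u := INR m) in *. set (f := INR (fact m)). set (v := 4 ^ m).
assert (Hv : 0 < v) by (apply pow_lt; lra).
replace (((u + 1) * f) ^ 2 / (4 * (u + 1 + 1) * (4 * v)))
  with (f ^ 2 / (4 * (u + 1) * v) * ((u + 1) ^ 3 / (4 * (u + 2)))) by (field; lra).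
apply Rmult_le_compat_l.
{ apply Rmult_le_pos; [apply pow2_ge_0|]. apply Rlt_le, Rinv_0_lt_compat.
  apply Rmult_lt_0_compat; lra. }
rewrite Hx.
apply Rmult_le_reg_r with ((588 / 100) ^ 2 * (4 * (u + 2))); [nra|].
replace ((2 * u + 3 + 2) ^ 2 / (588 / 100) ^ 2 * ((588 / 100) ^ 2 * (4 * (u + 2))))
  with ((2 * u + 5) ^ 2 * (4 * (u + 2))) by (field; lra).
replace ((u + 1) ^ 3 / (4 * (u + 2)) * ((588 / 100) ^ 2 * (4 * (u + 2))))
  with ((u + 1) ^ 3 * (588 / 100) ^ 2) by (field; lra).
(* What remains is 4 (u+2) (2u+5)^2 <= 5.88^2 (u+1)^3, false at u = 3 but true at u = 4. In w = u -
   4 the difference of the two sides has positive coefficients. *)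
assert (Hu : 0 <= u - 4) by lra. set (w := u - 4) in *. replace u with (w + 4) by (unfold w; ring).
pose proof (pow_le w 2 Hu). pose proof (pow_le w 3 Hu). simpl in *. nra.
Qed.

(** * One-to-one matching of the recovered nodes with the true ones *)

Lemma finite_choice n (P : nat -> nat -> Prop) :
  (forall k, (k < n)%nat -> exists p, P k p) ->
  exists f, forall k, (k < n)%nat -> P k (f k).
Proof.
induction n as [|n IH]; intros H; [exists (fun k => k); lia|].
destruct IH as [f Hf]; [intros; apply H; lia|].
destruct (H n (Nat.lt_succ_diag_r n)) as [p Hp].
exists (fun k => if Nat.eq_dec k n then p else f k). intros k Hk.
destruct (Nat.eq_dec k n) as [->|Hne]; [assumption | apply Hf; lia].
Qed.

Lemma perm_seq n (f : nat -> nat) :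
  (forall k, (k < n)%nat -> (f k < n)%nat) ->
  (forall i j, (i < n)%nat -> (j < n)%nat -> f i = f j -> i = j) ->
  Permutation (map f (seq 0 n)) (seq 0 n).
Proof.
intros Hlt Hinj. apply NoDup_Permutation_bis.
- apply NoDup_map_NoDup_ForallPairs; [|apply seq_NoDup].
  intros i j Hi Hj. apply in_seq in Hi, Hj. apply Hinj; lia.
- now rewrite length_map.
- intros p Hp. apply in_map_iff in Hp as [k [<- Hk]]. apply in_seq in Hk.
  apply in_seq. specialize (Hlt k). lia.
Qed.

Section Localization.
Variables (m : nat) (y yh : nat -> R) (d : R).
Let n := S (S m).
Hypothesis Hd : 0 < d.
Hypothesis Hsep : forall p q, (p < n)%nat -> (q < n)%nat -> p <> q -> d <= Rabs (y p - y q).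
(** The right-hand side is d (d/2)^2 times the lower bound of [exists_large_node] for k = m = n-2:
    exactly what two recovered nodes near one [y p] would contradict. *)
Hypothesis Hsmall : forall j, (j < n)%nat ->
  prodl (fun k => Rabs (y j - yh k)) (seq 0 n) *
  prodl (fun p => Rabs (y j - y p)) (rem j (seq 0 n)) <
  INR (fact m) ^ 2 / (4 * INR (S m) * 4 ^ m) * d ^ (2 * m + 3).
(* A node far from all [y p] needs [(m + 1)^3 / (2 (m + 2)) >= 1], which fails for m = 0. *)
Hypothesis Hsmall0 : m = 0%nat -> forall j, (j < n)%nat ->
  prodl (fun k => Rabs (y j - yh k)) (seq 0 n) *
  prodl (fun p => Rabs (y j - y p)) (rem j (seq 0 n)) < / 16 * d ^ 3.

Lemma in_seq_n k : In k (seq 0 n) <-> (k < n)%nat.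
Proof. rewrite in_seq. lia. Qed.

Lemma sep_seq p q :
  In p (seq 0 n) -> In q (seq 0 n) -> p <> q -> d <= Rabs (y p - y q).
Proof. rewrite !in_seq_n. apply Hsep. Qed.

(** If [yh k] is far from every node, [exists_large_node] with all n nodes and the other n-1
    recovered points as roots gives a large product at some j, and the omitted factor |y_j - yh_k|
    is still at least d/2. *)
Lemma exists_near_node k : (k < n)%nat -> exists p, (p < n)%nat /\ Rabs (yh k - y p) < d / 2.
Proof.
intros Hk.
destruct (Exists_dec (fun p => Rabs (yh k - y p) < d / 2) (seq 0 n)
  (fun p => Rlt_dec _ _)) as [H|H].
{ apply Exists_exists in H as [p [Hp H]]. exists p. now rewrite <- in_seq_n. }
exfalso. rewrite <- Forall_Exists_neg, Forall_forall in H.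
pose proof (proj2 (in_seq_n k) Hk) as Hk'.
pose proof (rem_length _ _ (seq_NoDup n 0) Hk') as Hlen. rewrite length_seq in Hlen.
destruct (exists_large_node y d (S m) (seq 0 n) (map yh (rem k (seq 0 n))) Hd
  (seq_NoDup n 0) sep_seq (length_seq n 0)) as [j [Hj Hlarge]].
{ rewrite length_map. unfold n in *. lia. }
rewrite prodl_map in Hlarge.
assert (Hjk : d / 2 <= Rabs (y j - yh k)).
{ rewrite Rabs_minus_sym. apply Rnot_lt_le, H, Hj. }
apply in_seq_n in Hj.
pose proof (Hsmall j Hj) as Hs. pose proof (fun E => Hsmall0 E j Hj) as Hs0.
rewrite (prodl_perm _ _ _ _ (rem_perm _ _ (seq_NoDup n 0) Hk')) in Hs, Hs0.
rewrite prodl_cons in Hs, Hs0.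
set (Q := prodl (fun k => Rabs (y j - yh k)) (rem k (seq 0 n))) in *.
set (W := prodl (fun p => Rabs (y j - y p)) (rem j (seq 0 n))) in *.
set (L := INR (fact (S m)) ^ 2 / (INR (S (S m)) * 4 ^ S m) * d ^ (2 * S m)) in *.
assert (HL : 0 < L).
{ unfold L. apply Rmult_lt_0_compat; [apply Rdiv_lt_0_compat|apply pow_lt; lra].
  - apply pow_lt, INR_fact_lt_0.
  - apply Rmult_lt_0_compat; [apply lt_0_INR; lia | apply pow_lt; lra]. }
assert (Hge : d / 2 * L <= Rabs (y j - yh k) * Q * W).
{ rewrite Rmult_assoc. apply Rmult_le_compat; lra. }
destruct m as [|m'] eqn:Em.
(* For n = 2 the lower bound d/2 * L is exactly d^3/16. *)
- specialize (Hs0 eq_refl). unfold L in Hge. simpl in Hge. lra.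
- apply (Rlt_irrefl (d / 2 * L)). eapply Rle_lt_trans; [exact Hge|].
  eapply Rlt_le_trans; [exact Hs|]. rewrite <- Em. unfold L. rewrite <- Em.
  assert (Hm : 1 <= INR m) by (apply (le_INR 1); lia).
  rewrite fact_simpl, mult_INR, !S_INR, <- (tech_pow_Rmult 4).
  replace (2 * S m)%nat with (2 * m + 2)%nat by lia. rewrite !pow_add.
  set (u := INR m) in *. set (f := INR (fact m)). set (v := 4 ^ m).
  assert (Hv : 0 < v) by (apply pow_lt; lra).
  set (D := d ^ (2 * m)). assert (HD : 0 < D) by (apply pow_lt; lra).
  replace (d / 2 * (((u + 1) * f) ^ 2 / ((u + 1 + 1) * (4 * v)) * (D * d ^ 2)))
    with (f ^ 2 / (4 * (u + 1) * v) * (D * d ^ 3) * ((u + 1) ^ 3 / (2 * (u + 2))))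
    by (field; lra).
  rewrite <- (Rmult_1_r (f ^ 2 / (4 * (u + 1) * v) * (D * d ^ 3))) at 1.
  apply Rmult_le_compat_l.
  + apply Rmult_le_pos.
    * apply Rmult_le_pos; [apply pow2_ge_0|]. apply Rlt_le, Rinv_0_lt_compat.
      apply Rmult_lt_0_compat; lra.
    * apply Rmult_le_pos; [lra | apply pow_le; lra].
  + apply Rmult_le_reg_r with (2 * (u + 2)); [lra|].
    replace ((u + 1) ^ 3 / (2 * (u + 2)) * (2 * (u + 2))) with ((u + 1) ^ 3) by (field; lra).
    nra.
Qed.

(** Dropping a and b from the roots and p from the nodes leaves degree n-2 and n-1 nodes. At the
    large node j, different from p, the dropped factors are at least d/2, d/2 and d. *)
Lemma near_node_inj a b p :
  (a < n)%nat -> (b < n)%nat -> (p < n)%nat ->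
  Rabs (yh a - y p) < d / 2 -> Rabs (yh b - y p) < d / 2 -> a = b.
Proof.
intros Ha Hb Hp Hap Hbp. destruct (Nat.eq_dec a b) as [|Hab]; [assumption|]. exfalso.
apply in_seq_n in Ha, Hb, Hp.
assert (Hd0 := seq_NoDup n 0).
assert (Hb' : In b (rem a (seq 0 n))) by (apply in_rem; auto).
pose proof (rem_NoDup _ _ Hd0 Ha) as Hda.
pose proof (rem_length _ _ Hd0 Ha) as La. pose proof (rem_length _ _ Hda Hb') as Lb.
pose proof (rem_length _ _ Hd0 Hp) as Lp. rewrite length_seq in La, Lp.
destruct (exists_large_node y d m (rem p (seq 0 n)) (map yh (rem b (rem a (seq 0 n)))) Hd)
  as [j [Hj Hlarge]].
- now apply rem_NoDup.
- intros q r Hq Hr. apply in_rem in Hq, Hr. now apply sep_seq.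
- unfold n in *; lia.
- rewrite length_map. unfold n in *; lia.
- rewrite prodl_map in Hlarge. apply in_rem in Hj as [Hj Hjp].
  pose proof (Hsmall j (proj1 (in_seq_n j) Hj)) as Hs.
  rewrite (prodl_perm _ _ _ _ (rem_perm _ _ Hd0 Ha)) in Hs.
  assert (Hp' : In p (rem j (seq 0 n))) by (apply in_rem; auto).
  rewrite (prodl_perm _ _ _ _ (rem_perm _ _ (rem_NoDup _ _ Hd0 Hj) Hp')) in Hs.
  rewrite !prodl_cons, (prodl_perm _ _ _ _ (rem_perm _ _ Hda Hb')), prodl_cons in Hs.
  (* The two removals are interchanged so that the product matches the one in [Hlarge]. *)
  unfold rem at 3 in Hs. unfold rem at 3 in Hs. rewrite remove_remove_comm in Hs.
  fold (rem p (seq 0 n)) in Hs. fold (rem j (rem p (seq 0 n))) in Hs.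
  set (Q := prodl (fun k => Rabs (y j - yh k)) (rem b (rem a (seq 0 n)))) in *.
  set (W := prodl (fun p => Rabs (y j - y p)) (rem j (rem p (seq 0 n)))) in *.
  pose proof (sep_seq j p Hj Hp Hjp) as Hjp'.
  assert (Hfar : forall z, Rabs (z - y p) < d / 2 -> d / 2 <= Rabs (y j - z)).
  { intros z Hz. pose proof (Rabs_triang (y j - z) (z - y p)) as Ht.
    replace (y j - z + (z - y p)) with (y j - y p) in Ht by ring. lra. }
  apply Hfar in Hap, Hbp.
  set (L := INR (fact m) ^ 2 / (INR (S m) * 4 ^ m) * d ^ (2 * m)) in *.
  assert (HL : 0 <= L).
  { unfold L. apply Rmult_le_pos; [apply Rmult_le_pos|apply pow_le; lra].
    - apply pow2_ge_0.
    - apply Rlt_le, Rinv_0_lt_compat.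
      apply Rmult_lt_0_compat; [apply lt_0_INR; lia | apply pow_lt; lra]. }
  apply (Rlt_irrefl (d / 2 * (d / 2) * d * L)).
  apply Rle_lt_trans with (Rabs (y j - yh a) * Rabs (y j - yh b) * Rabs (y j - y p) * (Q * W)).
  + apply Rmult_le_compat; [nra | assumption | | assumption].
    apply Rmult_le_compat; [nra | lra | | assumption].
    apply Rmult_le_compat; lra.
  + eapply Rle_lt_trans; [|eapply Rlt_le_trans; [exact Hs|]].
    * right; ring.
    * right. unfold L. rewrite pow_add. field.
      split; [apply pow_nonzero; lra | apply not_0_INR; lia].
Qed.

Lemma localization :
  within_nbhd n y yh (d / 2) /\
  exists perm : nat -> nat,
    (forall j, (j < n)%nat -> (perm j < n)%nat) /\
    (forall i j, (i < n)%nat -> (j < n)%nat -> perm i = perm j -> i = j) /\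
    (forall j, (j < n)%nat -> Rabs (yh (perm j) - y j) < d / 2).
Proof.
assert (Huniq : forall z p q, (p < n)%nat -> (q < n)%nat ->
  Rabs (z - y p) < d / 2 -> Rabs (z - y q) < d / 2 -> p = q).
{ intros z p q Hp Hq Hzp Hzq. destruct (Nat.eq_dec p q) as [|Hne]; [assumption|].
  pose proof (Hsep p q Hp Hq Hne) as Hpq.
  pose proof (Rabs_triang (y p - z) (z - y q)) as Ht.
  replace (y p - z + (z - y q)) with (y p - y q) in Ht by ring.
  rewrite (Rabs_minus_sym (y p) z) in Ht. lra. }
split.
{ intros k Hk. destruct (exists_near_node k Hk) as [p [Hp H]].
  exists p. split; [now split|]. intros q [Hq H']. now apply (Huniq (yh k)). }
destruct (finite_choice n _ exists_near_node) as [f Hf].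
assert (Hperm : Permutation (map f (seq 0 n)) (seq 0 n)).
{ apply perm_seq; [intros; now apply Hf|]. intros a b Ha Hb E.
  apply (near_node_inj a b (f a)); auto; try now apply Hf.
  rewrite E; now apply Hf. }
(* [f] sends a recovered index to its node, whereas the required reordering sends a node to its
   recovered index: it is the inverse [g]. *)
destruct (finite_choice n (fun j k => (k < n)%nat /\ f k = j)) as [g Hg].
{ intros j Hj. apply in_seq_n, (Permutation_in j (Permutation_sym Hperm)), in_map_iff in Hj.
  destruct Hj as [k [E Hk]]. exists k. now rewrite <- in_seq_n. }
exists g. split; [|split].
- intros; now apply Hg.
- intros i j Hi Hj E. destruct (Hg i Hi) as [_ <-]. destruct (Hg j Hj) as [_ <-]. now rewrite E.
- intros j Hj. destruct (Hg j Hj) as [Hlt E]. destruct (Hf (g j) Hlt) as [_ H].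
  now rewrite E in H.
Qed.

End Localization.

(** * From the Fourier samples to products of distances *)

Lemma prodl_scale_le A (f g : A -> R) c l :
  0 <= c -> (forall x, In x l -> 0 <= f x) -> (forall x, In x l -> c * f x <= g x) ->
  c ^ length l * prodl f l <= prodl g l.
Proof.
intros Hc Hf Hfg. rewrite <- prodl_scale. apply prodl_le.
intros x Hx. split; [apply Rmult_le_pos; auto | auto].
Qed.

(* Every [s]-th sample, with [s = (M-1)/(2n-1)], gives 2n equispaced samples whose
   step is short enough for [chord_ge] and long enough for the final constant. *)
Lemma sampling_step n M Om :
  (2 <= n)%nat -> (2 * n < M)%nat -> 0 < Om ->
  exists (s : nat) (h : R),
    Om / INR (2 * n - 1) <= h <= 2 * Om / INR (2 * n - 1) /\
    forall t, (t <= 2 * n - 1)%nat ->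
      (t * s < M)%nat /\ omega M Om (t * s) = - Om + INR t * h.
Proof.
intros Hn HM HOm. set (N := (2 * n - 1)%nat). set (s := ((M - 1) / N)%nat).
assert (HN : (0 < N)%nat) by (unfold N; lia).
assert (Hs1 : (1 <= s)%nat) by (apply Nat.div_le_lower_bound; unfold N; lia).
assert (Hlo : (N * s <= M - 1)%nat) by (apply Nat.Div0.mul_div_le).
(* As s >= 1, rounding down loses at most a factor 2: M - 1 < N (s+1) <= 2 N s. *)
assert (Hup : (M - 1 <= 2 * s * N)%nat).
{ pose proof (Nat.mul_succ_div_gt (M - 1) N ltac:(lia)) as H. fold s in H. nia. }
exists s, (INR s * (2 * Om / INR (M - 1))).
assert (HNr : 0 < INR N) by (apply lt_0_INR; lia).
assert (HMr : 0 < INR (M - 1)) by (apply lt_0_INR; lia).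
assert (Hlor := le_INR _ _ Hlo). apply le_INR in Hup.
rewrite mult_INR in Hlor. rewrite !mult_INR in Hup. simpl (INR 2) in Hup.
split; [split|].
- apply Rmult_le_reg_r with (INR N * INR (M - 1)); [nra|].
  replace (Om / INR N * (INR N * INR (M - 1))) with (Om * INR (M - 1)) by (field; lra).
  replace (INR s * (2 * Om / INR (M - 1)) * (INR N * INR (M - 1)))
    with (Om * (2 * INR s * INR N)) by (field; lra).
  apply Rmult_le_compat_l; lra.
- apply Rmult_le_reg_r with (INR N * INR (M - 1)); [nra|].
  replace (2 * Om / INR N * (INR N * INR (M - 1))) with (2 * Om * INR (M - 1))
    by (field; lra).
  replace (INR s * (2 * Om / INR (M - 1)) * (INR N * INR (M - 1)))
    with (2 * Om * (INR N * INR s)) by (field; lra).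
  apply Rmult_le_compat_l; lra.
- intros t Ht. split.
  + fold N in Ht. nia.
  + unfold omega. rewrite mult_INR. ring.
Qed.

Lemma node_products_le
  (n M : nat) (Om sigma : R) (are aim y : nat -> R) (Yre Yim : nat -> R)
  (ahre ahim yh : nat -> R) (mmin : R) :
  (2 <= n)%nat -> (2 * n < M)%nat -> 0 < Om -> 0 < mmin ->
  (forall j, (j < n)%nat -> in_I n Om (y j)) ->
  (forall j, (j < n)%nat -> in_I n Om (yh j)) ->
  (forall j, (j < n)%nat -> mmin <= cmod (are j) (aim j)) ->
  (forall q, (q < M)%nat ->
     cmod (Yre q - FT_re n are aim y (omega M Om q))
          (Yim q - FT_im n are aim y (omega M Om q)) < sigma) ->
  (forall q, (q < M)%nat ->
     cmod (FT_re n ahre ahim yh (omega M Om q) - Yre q)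
          (FT_im n ahre ahim yh (omega M Om q) - Yim q) < sigma) ->
  forall j, (j < n)%nat ->
  prodl (fun k => Rabs (y j - yh k)) (seq 0 n) *
  prodl (fun p => Rabs (y j - y p)) (rem j (seq 0 n)) <=
  2 * (PI * INR (2 * n - 1) / Om) ^ (2 * n - 1) * (sigma / mmin).
Proof.
intros Hn HM HOm Hm Hy Hyh Ha HW Hfit j Hj. pose proof PI_RGT_0 as Hpi.
destruct (sampling_step n M Om Hn HM HOm) as [s [h [Hh Ht]]].
set (N := (2 * n - 1)%nat) in *.
assert (HN : 0 < INR N) by (apply lt_0_INR; unfold N; lia).
assert (Hh0 : 0 < h) by (pose proof (Rdiv_lt_0_compat _ _ HOm HN); lra).
(* The phase of the first frequency -Om is absorbed into the amplitudes, whose moduli do not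
   change. *)
set (c := fun k => ((are k, aim k) * cis (y k * - Om))%C).
set (ch := fun k => ((ahre k, ahim k) * cis (yh k * - Om))%C).
assert (Hshift : forall bre bim x t, (t <= N)%nat ->
  (FT_re n bre bim x (omega M Om (t * s)), FT_im n bre bim x (omega M Om (t * s))) =
  csum n (fun k => ((bre k, bim k) * cis (x k * - Om) * cis (INR t * (h * x k)))%C)).
{ intros bre bim x t Htn. rewrite FT_csum. apply csum_ext. intros k _.
  rewrite <- Cmult_assoc, <- cis_plus. do 2 f_equal.
  rewrite (proj2 (Ht t Htn)). ring. }
assert (Hb : forall t, (t <= N)%nat ->
  Cmod (csum n (fun k => ch k * cis (INR t * (h * yh k))) -
        csum n (fun k => c k * cis (INR t * (h * y k))))%C <= 2 * sigma).
{ intros t Htn. unfold c, ch. rewrite <- !Hshift by assumption.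
  pose proof (proj1 (Ht t Htn)) as Hq.
  pose proof (HW _ Hq) as H1. pose proof (Hfit _ Hq) as H2.
  set (q := (t * s)%nat) in *.
  set (A := FT_re n ahre ahim yh (omega M Om q)) in *.
  set (B := FT_im n ahre ahim yh (omega M Om q)) in *.
  set (A' := FT_re n are aim y (omega M Om q)) in *.
  set (B' := FT_im n are aim y (omega M Om q)) in *.
  replace ((A, B) - (A', B'))%C
    with (((A - Yre q)%R, (B - Yim q)%R) + ((Yre q - A')%R, (Yim q - B')%R))%C
    by (unfold Cminus, Cplus, Copp; simpl; f_equal; ring).
  eapply Rle_trans; [apply Cmod_triangle|].
  change (cmod (A - Yre q) (B - Yim q) + cmod (Yre q - A') (Yim q - B') <= 2 * sigma).
  lra. }
pose proof (annihilation_bound n c ch _ _ _ j Hb Hj) as Hmain. fold N in Hmain.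
assert (Hcj : mmin <= Cmod (c j)).
{ unfold c. rewrite Cmod_mult, Cmod_cis, Rmult_1_r. apply (Ha j Hj). }
(* The chord constant 2/PI times the smallest possible step Om/(2n-1). *)
set (kappa := 2 * Om / (PI * INR N)).
assert (Hk : 0 < kappa) by (apply Rdiv_lt_0_compat; [lra | apply Rmult_lt_0_compat; lra]).
assert (Hchord : forall u, in_I n Om u ->
  kappa * Rabs (y j - u) <= Cmod (cis (h * y j) - cis (h * u))%C).
{ intros u Hu. eapply Rle_trans; [|apply chord_ge].
  - rewrite <- Rmult_minus_distr_l, Rabs_mult, (Rabs_pos_eq h) by lra.
    rewrite <- Rmult_assoc. apply Rmult_le_compat_r; [apply Rabs_pos|].
    unfold kappa. replace (2 * Om / (PI * INR N)) with (2 / PI * (Om / INR N)) by (field; lra).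
    apply Rmult_le_compat_l; [apply Rlt_le, Rdiv_lt_0_compat; lra | apply Hh].
  - rewrite <- Rmult_minus_distr_l, Rabs_mult, (Rabs_pos_eq h) by lra.
    (* [chord_ge] needs an angle at most PI: the step is at most 2 Om/(2n-1) and two points of the
       interval are at most (n-1) PI/Om apart, which gives PI (2n-2)/(2n-1). *)
    set (w := INR (n - 1) * PI / (2 * Om)).
    assert (Hd : Rabs (y j - u) <= 2 * w).
    { pose proof (Hy j Hj) as Hyj. unfold in_I in Hyj, Hu. fold w in Hyj, Hu.
      unfold Rabs; destruct Rcase_abs; lra. }
    apply Rle_trans with (2 * Om / INR N * (2 * w)).
    + apply Rmult_le_compat; [lra | apply Rabs_pos | apply Hh | assumption].
    + unfold w. replace (2 * Om / INR N * (2 * (INR (n - 1) * PI / (2 * Om))))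
        with (PI * (2 * INR (n - 1)) / INR N) by (field; lra).
      apply Rmult_le_reg_r with (INR N); [assumption|].
      replace (PI * (2 * INR (n - 1)) / INR N * INR N) with (PI * (2 * INR (n - 1)))
        by (field; lra).
      apply Rmult_le_compat_l; [lra|].
      replace 2 with (INR 2) by (simpl; ring). rewrite <- mult_INR.
      apply le_INR. unfold N. lia. }
assert (Hjs : In j (seq 0 n)) by (apply in_seq; lia).
pose proof (rem_length _ _ (seq_NoDup n 0) Hjs) as Hlen. rewrite length_seq in Hlen.
set (P1 := prodl (fun k => Rabs (y j - yh k)) (seq 0 n)).
set (P2 := prodl (fun p => Rabs (y j - y p)) (rem j (seq 0 n))).
assert (H1 : kappa ^ n * P1 <=
  prodl (fun k => Cmod (cis (h * y j) - cis (h * yh k))%C) (seq 0 n)).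
{ rewrite <- (length_seq n 0) at 1. apply prodl_scale_le; [lra | intros; apply Rabs_pos|].
  intros k Hkin. apply in_seq in Hkin. apply Hchord, Hyh. lia. }
assert (H2 : kappa ^ (n - 1) * P2 <=
  prodl (fun p => Cmod (cis (h * y j) - cis (h * y p))%C) (rem j (seq 0 n))).
{ replace (n - 1)%nat with (length (rem j (seq 0 n))) by lia.
  apply prodl_scale_le; [lra | intros; apply Rabs_pos|].
  intros p Hp. apply in_rem in Hp as [Hp _]. apply in_seq in Hp. apply Hchord, Hy. lia. }
assert (HP1 : 0 <= P1) by (apply prodl_ge0; intros; apply Rabs_pos).
assert (HP2 : 0 <= P2) by (apply prodl_ge0; intros; apply Rabs_pos).
assert (Hall : mmin * ((kappa ^ n * P1) * (kappa ^ (n - 1) * P2)) <= 2 ^ N * (2 * sigma)).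
{ eapply Rle_trans; [|exact Hmain].
  assert (0 <= kappa ^ n * P1) by (apply Rmult_le_pos; [apply pow_le; lra | assumption]).
  assert (0 <= kappa ^ (n - 1) * P2)
    by (apply Rmult_le_pos; [apply pow_le; lra | assumption]).
  apply Rmult_le_compat; [lra | apply Rmult_le_pos; assumption | assumption|].
  apply Rmult_le_compat; assumption. }
assert (HkN : 0 < kappa ^ N) by (apply pow_lt; assumption).
apply Rmult_le_reg_l with (mmin * kappa ^ N); [apply Rmult_lt_0_compat; assumption|].
replace (mmin * kappa ^ N * (P1 * P2))
  with (mmin * ((kappa ^ n * P1) * (kappa ^ (n - 1) * P2))).
2:{ replace N with (n + (n - 1))%nat by (unfold N; lia). rewrite pow_add. ring. }
eapply Rle_trans; [exact Hall|]. right.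
replace (PI * INR N / Om) with (2 * / kappa) by (unfold kappa; field; lra).
rewrite Rpow_mult_distr, pow_inv. field. lra.
Qed.

(** * The separation condition and the constant C(n) *)

Lemma noise_ratio_le n Om rho d :
  (2 <= n)%nat -> 0 < Om -> 0 < rho ->
  d >= 588 / 100 * PI * exp 1 / Om * Rpower rho (1 / INR (2 * n - 1)) ->
  2 * (PI * INR (2 * n - 1) / Om) ^ (2 * n - 1) * rho <=
  2 * (INR (2 * n - 1) / (588 / 100 * exp 1)) ^ (2 * n - 1) * d ^ (2 * n - 1).
Proof.
intros Hn HOm Hrho Hd. set (N := (2 * n - 1)%nat) in *.
assert (HN : 0 < INR N) by (apply lt_0_INR; unfold N; lia).
pose proof PI_RGT_0 as Hpi. pose proof exp1_ge as He.
set (r := Rpower rho (1 / INR N)) in *.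
assert (Hr : 0 < r) by apply exp_pos.
assert (Er : r ^ N = rho).
{ rewrite <- Rpower_pow by assumption. unfold r. rewrite Rpower_mult.
  replace (1 / INR N * INR N) with 1 by (field; lra). now apply Rpower_1. }
rewrite <- Er, !Rmult_assoc, <- !Rpow_mult_distr.
apply Rmult_le_compat_l; [lra|]. apply pow_incr. split.
- apply Rmult_le_pos; [|lra]. apply Rlt_le, Rdiv_lt_0_compat; [nra | assumption].
- replace (PI * INR N / Om * r)
    with (INR N / (588 / 100 * exp 1) * (588 / 100 * PI * exp 1 / Om * r)) by (field; lra).
  apply Rmult_le_compat_l; [|lra]. apply Rlt_le, Rdiv_lt_0_compat; lra.
Qed.

Lemma error_const_le n Om :
  (2 <= n)%nat -> 0 < Om ->
  2 * (PI * INR (2 * n - 1) / Om) ^ (2 * n - 1) <=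
  Cn n / Om * (PI / Om) ^ (2 * n - 2) * (INR (fact (n - 1)) ^ 2 / 4 ^ (n - 1)).
Proof.
intros Hn HOm. destruct n as [|m]; [lia|].
replace (2 * S m - 1)%nat with (S (2 * m)) by lia.
replace (2 * S m - 2)%nat with (2 * m)%nat by lia.
replace (S m - 1)%nat with m by lia.
unfold Cn. replace (4 * S m - 2)%nat with (2 * m + (2 * m + 2))%nat by lia.
pose proof PI_RGT_0 as Hpi. pose proof PI_le as Hpi'. pose proof exp1_ge as He.
assert (Hsm : 0 < INR (S m)) by (apply lt_0_INR; lia).
assert (Hsq : 0 < sqrt PI) by (apply sqrt_lt_R0; assumption).
assert (Hsq2 : sqrt PI <= 19 / 10).
{ rewrite <- (sqrt_pow2 (19 / 10)) by lra. apply sqrt_le_1; lra. }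
assert (Hpe : PI * sqrt PI <= exp 1 ^ 2).
{ apply Rle_trans with (52 / 15 * (19 / 10)); [apply Rmult_le_compat; lra|]. nra. }
pose proof (pow_le_fact_exp m) as Hst.
set (x := INR (S m)) in *. set (F := INR (fact m)) in *. set (e := exp 1) in *.
set (q := PI / Om). assert (Hq : 0 < q) by (apply Rdiv_lt_0_compat; assumption).
assert (Hx1 : INR (S (2 * m)) <= 2 * x).
{ unfold x. rewrite !S_INR, mult_INR. simpl (INR 2). pose proof (pos_INR m). lra. }
apply Rle_trans with (2 * (q * (2 * x)) ^ S (2 * m)).
{ apply Rmult_le_compat_l; [lra|]. apply pow_incr.
  replace (PI * INR (S (2 * m)) / Om) with (q * INR (S (2 * m))) by (unfold q; field; lra).
  pose proof (pos_INR (S (2 * m))). split; [apply Rmult_le_pos; lra|].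
  apply Rmult_le_compat_l; lra. }
(* With x = n = m+1, this is the whole estimate once the common powers are factored out: the square
   of the Stirling bound times PI^(3/2) <= e^2. *)
assert (Hkey : PI * sqrt PI * x ^ (2 * m) <= e ^ (2 * S m) * F ^ 2).
{ replace (e ^ (2 * S m) * F ^ 2) with (e ^ 2 * (F * e ^ m) ^ 2).
  2:{ rewrite Rpow_mult_distr, <- pow_mult. replace (2 * S m)%nat with (2 + m * 2)%nat by lia.
      rewrite pow_add. ring. }
  rewrite (Nat.mul_comm 2 m), pow_mult.
  apply Rmult_le_compat; [nra | apply pow2_ge_0 | assumption|].
  apply pow_incr. split; [apply pow_le; lra | assumption]. }
set (y := sqrt PI) in *.
replace (2 * (q * (2 * x)) ^ S (2 * m))
  with (PI * y * x ^ (2 * m) * (q ^ (2 * m) * x * 2 ^ (2 * m) * 4 / (Om * y))).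
2:{ rewrite <- tech_pow_Rmult, !Rpow_mult_distr. unfold q at 2. field. lra. }
replace (x * 2 ^ (2 * m + (2 * m + 2)) * e ^ (2 * S m) / y / Om * q ^ (2 * m) * (F ^ 2 / 4 ^ m))
  with (e ^ (2 * S m) * F ^ 2 * (q ^ (2 * m) * x * 2 ^ (2 * m) * 4 / (Om * y))).
2:{ rewrite !pow_add, (pow_mult 2 2 m). replace (2 ^ 2) with 4 by ring.
    field. split; [apply pow_nonzero|]; lra. }
apply Rmult_le_compat_r; [|exact Hkey].
apply Rmult_le_pos.
- repeat apply Rmult_le_pos; try lra; apply pow_le; lra.
- apply Rlt_le, Rinv_0_lt_compat, Rmult_lt_0_compat; assumption.
Qed.

(** * Error estimate and conclusion *)

Lemma matched_error_le n (y yh : nat -> R) (perm : nat -> nat) d K j :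
  0 < d ->
  (forall p q, (p < n)%nat -> (q < n)%nat -> p <> q -> d <= Rabs (y p - y q)) ->
  (forall j, (j < n)%nat -> (perm j < n)%nat) ->
  (forall i j, (i < n)%nat -> (j < n)%nat -> perm i = perm j -> i = j) ->
  (forall j, (j < n)%nat -> Rabs (yh (perm j) - y j) < d / 2) ->
  (j < n)%nat ->
  prodl (fun k => Rabs (y j - yh k)) (seq 0 n) *
  prodl (fun p => Rabs (y j - y p)) (rem j (seq 0 n)) <= K ->
  Rabs (yh (perm j) - y j) * (INR (fact (n - 1)) ^ 2 / 4 ^ (n - 1) * d ^ (2 * n - 2)) <= K.
Proof.
intros Hd Hsep Hlt Hinj Hnear Hj HK.
assert (Hjs : In j (seq 0 n)) by (apply in_seq; lia).
pose proof (rem_length _ _ (seq_NoDup n 0) Hjs) as Hlen. rewrite length_seq in Hlen.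
eapply Rle_trans; [|exact HK].
(* Reindexing by [perm] pairs |y_j - yh_(perm p)| with |y_j - y_p|, and p = j isolates the error to
   be bounded. *)
rewrite <- (prodl_perm _ _ _ _ (perm_seq n perm Hlt Hinj)), prodl_map.
rewrite (prodl_perm _ _ _ _ (rem_perm _ _ (seq_NoDup n 0) Hjs)), prodl_cons.
rewrite Rmult_assoc, (Rabs_minus_sym (y j)), <- prodl_mult.
apply Rmult_le_compat_l; [apply Rabs_pos|].
set (r := rem j (seq 0 n)) in *.
assert (Hr : forall p, In p r -> (p < n)%nat /\ p <> j).
{ intros p Hp. apply in_rem in Hp as [Hp Hne]. apply in_seq in Hp. split; [lia | assumption]. }
(* With s = |y_j - y_p|/d, the triangle inequality bounds the pair of factors at p below by d^2 s (s
   - 1/2), which increases for s >= 1. *)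
pose proof (separated_prodl_ge (fun s => s * (s - 1 / 2)) y (y j) d r Hd
  (rem_NoDup _ _ (seq_NoDup n 0) Hjs)) as Hge.
replace (n - 1)%nat with (length r) by lia.
replace (2 * n - 2)%nat with (2 * length r)%nat by lia. rewrite pow_mult.
apply Rle_trans with
  (prodl (fun p => Rabs (y j - y p) / d * (Rabs (y j - y p) / d - 1 / 2)) r
   * (d ^ 2) ^ length r).
- apply Rmult_le_compat_r; [apply pow_le, pow2_ge_0|].
  eapply Rle_trans; [apply prodl_half_sq_ge_fact_sq|]. apply Hge.
  + intros p q Hp Hq Hne. apply Hsep; auto; now apply Hr.
  + intros p Hp. destruct (Hr p Hp). apply Hsep; auto.
  + intros s Hs. nra.
  + intros s t Hst. nra.
- rewrite Rmult_comm. apply prodl_scale_le; [apply pow2_ge_0 | |].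
  + intros p Hp. destruct (Hr p Hp) as [Hpn Hne].
    assert (Hg : 1 <= Rabs (y j - y p) / d).
    { apply Rmult_le_reg_r with d; [assumption|].
      replace (Rabs (y j - y p) / d * d) with (Rabs (y j - y p)) by (field; lra).
      rewrite Rmult_1_l. apply Hsep; auto. }
    nra.
  + intros p Hp. destruct (Hr p Hp) as [Hpn Hne].
    pose proof (Hnear p Hpn) as Hpp. pose proof (Hsep j p Hj Hpn (not_eq_sym Hne)) as Hjp.
    pose proof (Rabs_triang (y j - yh (perm p)) (yh (perm p) - y p)) as Ht.
    replace (y j - yh (perm p) + (yh (perm p) - y p)) with (y j - y p) in Ht by ring.
    set (a := Rabs (y j - y p)) in *. set (b := Rabs (y j - yh (perm p))) in *.
    replace (d ^ 2 * (a / d * (a / d - 1 / 2))) with ((a - d / 2) * a) by (field; lra).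
    apply Rmult_le_compat_r; lra.
Qed.

Theorem theorem2p2
  (n M : nat) (Om sigma : R)
  (are aim y : nat -> R)        (* mu = sum_j (are j + i aim j) delta_{y j} *)
  (mmin dmin : R)
  (Yre Yim : nat -> R)          (* measurement vector Y, entries q0 < M *)
  (ahre ahim yh : nat -> R)     (* hat mu *)
  (Hn : (2 <= n)%nat)
  (HM : (2 * n < M)%nat)
  (HOm : 0 < Om)
  (Ha : forall j, (j < n)%nat -> cmod (are j) (aim j) <> 0)
  (Hy : forall j, (j < n)%nat -> in_I n Om (y j))
  (Hdist : forall p j, (p < n)%nat -> (j < n)%nat -> p <> j -> y p <> y j)
  (Hmmin1 : forall j, (j < n)%nat -> mmin <= cmod (are j) (aim j))
  (Hmmin2 : exists j, (j < n)%nat /\ mmin = cmod (are j) (aim j))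
  (Hdmin1 : forall p j, (p < n)%nat -> (j < n)%nat -> p <> j ->
              dmin <= Rabs (y p - y j))
  (Hdmin2 : exists p j, (p < n)%nat /\ (j < n)%nat /\ p <> j /\
              dmin = Rabs (y p - y j))
  (* Y = [mu] + W with ||W||_inf < sigma *)
  (HW : forall q, (q < M)%nat ->
          cmod (Yre q - FT_re n are aim y (omega M Om q))
               (Yim q - FT_im n are aim y (omega M Om q)) < sigma)
  (Hsep : dmin >= 588 / 100 * PI * exp 1 / Om *
                  Rpower (sigma / mmin) (1 / INR (2 * n - 1)))
  (Hyh : forall j, (j < n)%nat -> in_I n Om (yh j))
  (Hfit : forall q, (q < M)%nat ->
          cmod (FT_re n ahre ahim yh (omega M Om q) - Yre q)
               (FT_im n ahre ahim yh (omega M Om q) - Yim q) < sigma) :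
  within_nbhd n y yh (dmin / 2) /\
  exists perm : nat -> nat,
    (forall j, (j < n)%nat -> (perm j < n)%nat) /\
    (forall i j, (i < n)%nat -> (j < n)%nat -> perm i = perm j -> i = j) /\
    (forall j, (j < n)%nat ->
       Rabs (yh (perm j) - y j) <=
         Cn n / Om * (PI / (Om * dmin)) ^ (2 * n - 2) * (sigma / mmin)).
Proof.
assert (Hm : 0 < mmin).
{ destruct Hmmin2 as [j [Hj ->]]. specialize (Ha j Hj).
  pose proof (sqrt_pos (are j ^ 2 + aim j ^ 2)). unfold cmod in *. lra. }
assert (Hd : 0 < dmin).
{ destruct Hdmin2 as [p [j [Hp [Hj [Hne ->]]]]].
  apply Rabs_pos_lt, Rminus_eq_contra. auto. }
assert (Hs : 0 < sigma).
{ eapply Rle_lt_trans; [apply sqrt_pos | apply (HW 0%nat); lia]. }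
set (rho := sigma / mmin) in *.
assert (Hrho : 0 < rho) by (apply Rdiv_lt_0_compat; assumption).
pose proof (node_products_le n M Om sigma are aim y Yre Yim ahre ahim yh mmin
  Hn HM HOm Hm Hy Hyh Hmmin1 HW Hfit) as Hprod.
pose proof (noise_ratio_le n Om rho dmin Hn HOm Hrho Hsep) as Hnoise.
fold rho in Hprod.
assert (Hloc : within_nbhd n y yh (dmin / 2) /\
  exists perm : nat -> nat,
    (forall j, (j < n)%nat -> (perm j < n)%nat) /\
    (forall i j, (i < n)%nat -> (j < n)%nat -> perm i = perm j -> i = j) /\
    (forall j, (j < n)%nat -> Rabs (yh (perm j) - y j) < dmin / 2)).
{ destruct n as [|[|m]]; [lia | lia|].
  replace (2 * S (S m) - 1)%nat with (2 * m + 3)%nat in * by lia.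
  apply (localization m y yh dmin Hd Hdmin1).
  - intros j Hj. eapply Rle_lt_trans; [apply (Hprod j Hj)|].
    eapply Rle_lt_trans; [exact Hnoise|].
    apply Rmult_lt_compat_r; [apply pow_lt; assumption | apply resolution_const_lt].
  (* For n = 2 there is ample room: 2 (3/(5.88 * 2.6))^3 is about 0.015, below 1/16. *)
  - intros -> j Hj. eapply Rle_lt_trans; [apply (Hprod j Hj)|].
    eapply Rle_lt_trans; [exact Hnoise|].
    apply Rmult_lt_compat_r; [apply pow_lt; assumption|].
    pose proof exp1_ge as He.
    apply Rle_lt_trans with (2 * (3 / (588 / 100 * (26 / 10))) ^ 3); [|lra].
    apply Rmult_le_compat_l; [lra|]. replace (INR (2 * 0 + 3)) with 3 by (simpl; ring).
    apply pow_incr. split; [apply Rlt_le, Rdiv_lt_0_compat; lra|].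
    apply Rmult_le_compat_l; [lra|]. apply Rinv_le_contravar; lra. }
destruct Hloc as [Hnbhd [perm [Hlt [Hinj Hnear]]]].
split; [assumption|]. exists perm. split; [assumption|]. split; [assumption|].
intros j Hj.
pose proof (matched_error_le n y yh perm dmin _ j Hd Hdmin1 Hlt Hinj Hnear Hj (Hprod j Hj))
  as Herr.
set (G := INR (fact (n - 1)) ^ 2 / 4 ^ (n - 1)) in *.
assert (HG : 0 < G).
{ apply Rdiv_lt_0_compat; apply pow_lt; [apply INR_fact_lt_0 | lra]. }
assert (HD : 0 < dmin ^ (2 * n - 2)) by (apply pow_lt; assumption).
(* Multiplying by the lower bound for all factors other than the error reduces the claim to
   [error_const_le]. *)
apply Rmult_le_reg_r with (G * dmin ^ (2 * n - 2)); [apply Rmult_lt_0_compat; assumption|].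
eapply Rle_trans; [exact Herr|].
eapply Rle_trans; [apply Rmult_le_compat_r; [lra | apply (error_const_le n Om Hn HOm)]|].
fold G. right.
replace (PI / (Om * dmin)) with (PI / Om * / dmin) by (field; lra).
rewrite Rpow_mult_distr, pow_inv. field. lra.
Qed.
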